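(* Let $G$ be a (connected) Ptolemaic graph. Then $G$ is smooth if and only if $G$ is $K_{1,1,3}$-free.
   Context: Graphs are simple and undirected; $d$ denotes the shortest path distance of a connected graph $G$. Intervals: $I[u,v]=\{w\in V(G): d(u,w)+d(w,v)=d(u,v)\}$; $N(u)=\{w: d(u,w)=1\}$; the step system (step function) of $G$ is $S(u,v)=I[u,v]\cap N(u)$. A connected graph $G$ is smooth if for all vertices $u,v,w,x,y$: $v\in S(u,w)$, $v\in S(u,y)$ and $x\in S(w,y)$ imply $v\in S(u,x)$. $G$ is Ptolemaic if any four vertices $u,v,w,x$ satisfy $d(u,v)d(w,x)+d(u,x)d(v,w)\ge d(u,w)d(v,x)$. $G$ is $H$-free if it does not contain $H$ as an induced subgraph. $K_{1,1,3}$ is the complete tripartite graph with parts of sizes $1,1,3$. *)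

(* Defs.v *)
From mathcomp Require Import all_boot.
From mathcomp Require Import boolp classical_sets.

Set Implicit Arguments.
Unset Strict Implicit.
Unset Printing Implicit Defensive.

(* The vertex type is arbitrary (finiteness is not assumed).  Adjacency is
   boolean, which is no restriction since we reason classically. *)
Record sgraph := SGraph {
  vertex :> Type;
  adj : rel vertex;
  adj_sym : symmetric adj;
  adj_irr : irreflexive adj
}.

Section Metric.
Variable G : sgraph.
Implicit Types u v w : G.

Definition walk u v (n : nat) : Prop :=
  exists p : seq G, [/\ path (@adj G) u p, last u p = v & size p = n].

Definition connected : Prop := forall u v, exists n, walk u v n.

Lemma walk_asbool u v : (exists n, walk u v n) -> exists n, `[< walk u v n >].
Proof. by case=> n h; exists n; apply/asboolP. Qed.

(* Least length of a walk, which is the least length of a path; the value is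
   the junk 0 when v is not reachable from u. *)
Definition dist u v : nat :=
  match pselect (exists n, walk u v n) with
  | left h => ex_minn (walk_asbool h)
  | right _ => 0
  end.

Lemma dist_walk u v : (exists n, walk u v n) -> walk u v (dist u v).
Proof.
by rewrite /dist; case: pselect => // h _; case: ex_minnP => m /asboolP.
Qed.

Lemma dist_min u v n : walk u v n -> dist u v <= n.
Proof.
move=> wn; rewrite /dist; case: pselect => [h|//].
by case: ex_minnP => m _; apply; apply/asboolP.
Qed.

Definition interval u v : set G := [set w | dist u w + dist w v = dist u v]%classic.

Definition nbhd u : set G := [set w | dist u w = 1]%classic.

Definition step u v : set G := (interval u v `&` nbhd u)%classic.

Definition smooth : Prop := forall u v w x y : G,
  v \in step u w -> v \in step u y -> x \in step w y -> v \in step u x.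

Definition ptolemaic : Prop := forall u v w x : G,
  dist u v * dist w x + dist u x * dist v w >= dist u w * dist v x.

End Metric.

Definition induced_subgraph (H G : sgraph) : Prop :=
  exists f : H -> G, injective f /\ forall x y, adj (f x) (f y) = adj x y.

Definition induced_free (H G : sgraph) : Prop := ~ induced_subgraph H G.

Section CompleteMultipartite.
Variable s : seq nat.

(* The vertices are the pairs of a part i and an element of that part, whose
   size is the i-th entry of s. *)
Definition cmp_vertex := {i : 'I_(size s) & 'I_(nth 0 s i)}.

Definition cmp_adj : rel cmp_vertex := fun x y => tag x != tag y.

Lemma cmp_adj_sym : symmetric cmp_adj.
Proof. by move=> x y; rewrite /cmp_adj eq_sym. Qed.

Lemma cmp_adj_irr : irreflexive cmp_adj.
Proof. by move=> x; rewrite /cmp_adj eqxx. Qed.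

Definition complete_multipartite : sgraph := SGraph cmp_adj_sym cmp_adj_irr.

End CompleteMultipartite.

Definition K113 : sgraph := complete_multipartite [:: 1; 1; 3].

(* Main.v *)
Require Import Defs.
From mathcomp Require Import all_boot.
From mathcomp Require Import classical_sets zify.

Set Implicit Arguments.
Unset Strict Implicit.
Unset Printing Implicit Defensive.

(** In a copy of K_{1,1,3} with singleton parts a, b and independent part c1,
    c2, c3, the vertex a is a step from c1 towards c2 and towards c3, and b is
    a step from c2 towards c3; but a is not a step from c1 towards its
    neighbour b.  So smoothness excludes K_{1,1,3}
    ([smooth_free_K113]).

    Conversely, let v be a step from u towards w and y, and x a step from w
    towards y, while v is not a step from u towards x.  The Ptolemaic
    inequality applied to u, v, w, x reads
      (d(v,w) + 1) d(v,x) <= 1 + d(u,x) d(v,w),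
    and failure of smoothness says d(u,x) <= d(v,x); together they force
    d(v,x) <= 1, and the remaining triangle inequalities leave a single
    configuration ([smooth_failure_diamond]): u, v, x, w is a diamond with
    missing edge uw, the vertices v and x are at the same distance b >= 1 from
    y, and u and w are at distance b + 1 from y.  A neighbour z of v with
    d(z,y) = b - 1 is then also a neighbour of x
    ([ptolemaic_common_parent]), and it is too close to y to be adjacent to u
    or w.  Hence {v}, {x}, {u, w, z} induce K_{1,1,3}. *)

(** * The path metric *)

Lemma walk_sym (G : sgraph) (u v : G) n : walk u v n -> walk v u n.
Proof.
case=> p [pth lst szp]; exists (rev (belast u p)); split.
- rewrite -lst rev_path (eq_path (e' := @adj G)) // => a b.
  exact: adj_sym.
- case: p lst {pth szp} => [|a p] //= _.
  by rewrite rev_cons last_rcons.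
- by rewrite size_rev size_belast.
Qed.

Lemma walk_cat (G : sgraph) (u v w : G) m n :
  walk u v m -> walk v w n -> walk u w (m + n).
Proof.
case=> p [pp lp sp] [q [pq lq sq]]; exists (p ++ q).
by split; rewrite ?cat_path ?last_cat ?size_cat ?lp ?pp ?sp ?sq.
Qed.

Section Connected.
Variables (G : sgraph) (Gconn : connected G).
Implicit Types u v w x y z : G.

Lemma dist_geodesic u v : walk u v (dist u v).
Proof. exact/dist_walk/Gconn. Qed.

Lemma distxx u : dist u u = 0.
Proof.
by apply/eqP; rewrite -leqn0; apply: dist_min; exists [::].
Qed.

Lemma dist0_eq u v : dist u v = 0 -> u = v.
Proof.
move=> duv; have := dist_geodesic u v; rewrite duv.
by case=> p [_ <- /size0nil ->].
Qed.

Lemma dist_sym u v : dist u v = dist v u.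
Proof.
by apply/eqP; rewrite eqn_leq !dist_min //; exact/walk_sym/dist_geodesic.
Qed.

Lemma dist_triangle u v w : dist u w <= dist u v + dist v w.
Proof. exact/dist_min/walk_cat/dist_geodesic/dist_geodesic. Qed.

Lemma adj_dist u v : adj u v = (dist u v == 1).
Proof.
apply/idP/eqP => [auv|duv].
  have : dist u v <= 1 by apply: dist_min; exists [:: v]; rewrite /= auv.
  case: (dist u v) (@dist0_eq u v) => [/(_ erefl) uv|[]//].
  by move: auv; rewrite uv adj_irr.
have := dist_geodesic u v; rewrite duv.
by case=> -[|a [|a' p]] [] //= /andP[? _] <-.
Qed.

Lemma dist_eq2 u v w : u <> w -> ~~ adj u w -> adj u v -> adj v w ->
  dist u w = 2.
Proof.
rewrite !adj_dist => uw nuw /eqP uv /eqP vw.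
have := dist_triangle u v w; have := @dist0_eq u w; rewrite uv vw.
by case: (dist u w) nuw => [|[|[|]]] // _ /(_ erefl) /uw.
Qed.

Lemma dist_first_step u v n : dist u v = n.+1 ->
  exists2 z, dist u z = 1 & dist z v = n.
Proof.
move=> duv; have := dist_geodesic u v; rewrite duv.
case=> -[|z p] [] //= /andP[auz pth] lst [szp].
have zv : dist z v <= n by apply: dist_min; exists p.
have /eqP uz : dist u z == 1 by rewrite -adj_dist.
by exists z => //; have := dist_triangle u z v; lia.
Qed.

Lemma in_step v u w :
  v \in step u w <-> dist u v = 1 /\ dist u w = (dist v w).+1.
Proof.
rewrite in_setE; split=> [[/= uvw uv]|[uv uw]]; last first.
  by split; [rewrite /interval /= uv uw|].
by rewrite -uvw uv.
Qed.

(** * Smooth graphs have no induced K_{1,1,3} *)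

Definition K113_vertex i (lti : i < 3) j (ltj : j < nth 0 [:: 1; 1; 3] i) :
  K113 :=
  @existT 'I_3 (fun i => 'I_(nth 0 [:: 1; 1; 3] i)) (Ordinal lti) (Ordinal ltj).

Lemma smooth_free_K113 : smooth G -> induced_free K113 G.
Proof.
move=> smoothG [f [injf adjf]].
pose a : K113 := @K113_vertex 0 isT 0 isT.
pose b : K113 := @K113_vertex 1 isT 0 isT.
pose c j (ltj : j < 3) : K113 := @K113_vertex 2 isT j ltj.
pose c1 := c 0 isT; pose c2 := c 1 isT; pose c3 := c 2 isT.
have dist1 (s t : K113) : adj s t -> dist (f s) (f t) = 1.
  by rewrite -adjf adj_dist => /eqP.
have dist2 j k (ltj : j < 3) (ltk : k < 3) : j <> k ->
    dist (f (c j ltj)) (f (c k ltk)) = 2.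
  move=> jk; apply: (@dist_eq2 _ (f a)); rewrite ?adjf //.
  by move/injf/(congr1 (fun s : K113 => nat_of_ord (tagged s))).
have /in_step[_] : f a \in step (f c1) (f b).
  apply: (smoothG _ _ (f c2) _ (f c3)); apply/in_step.
  - by rewrite (dist1 c1 a) ?(dist1 a c2) ?dist2.
  - by rewrite (dist1 c1 a) ?(dist1 a c3) ?dist2.
  - by rewrite (dist1 c2 b) ?(dist1 b c3) ?dist2.
by rewrite (dist1 c1 b) ?(dist1 a b).
Qed.

(** * Failure of smoothness in a Ptolemaic graph *)

(** Distinctness has to be assumed only within the independent part: vertices
    of different parts are adjacent, hence distinct. *)
Lemma induced_K113 (a b c1 c2 c3 : G) :
    adj a b -> all (adj a) [:: c1; c2; c3] -> all (adj b) [:: c1; c2; c3] ->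
    ~~ adj c1 c2 -> ~~ adj c1 c3 -> ~~ adj c2 c3 ->
    c1 <> c2 -> c1 <> c3 -> c2 <> c3 ->
  induced_subgraph K113 G.
Proof.
move=> ab /and4P[a1 a2 a3 _] /and4P[b1 b2 b3 _].
move=> /negbTE n12 /negbTE n13 /negbTE n23 d12 d13 d23.
pose f (t : K113) :=
  nth a (nth [::] [:: [:: a]; [:: b]; [:: c1; c2; c3]] (tag t)) (tagged t).
pose edges := (ab, a1, a2, a3, b1, b2, b3, n12, n13, n23).
have adjf s t : adj (f s) (f t) = adj s t.
  case: s t => -[[|[|[|//]]] i] [[|[|[|//]]] i'] //=
    [[[|[|[|//]]] j] [[|[|[|//]]] j']] //=;
  by rewrite /f /= ?adj_irr ?edges // [in LHS]adj_sym edges.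
exists f; split=> // s t eqf.
have same_part : tag s = tag t.
  by apply/eqP/negPn; rewrite -[tag s != _]/(adj s t) -adjf eqf adj_irr.
case: s t same_part eqf => [i s] [j t] /= eij.
rewrite -{}eij in t * => {j} eqf; congr existT; apply/val_inj.
case: i s t eqf => -[|[|[|//]]] i [[|[|[|//]]] j] [[|[|[|//]]] j'] //= eqf;
  by [case: (d12 eqf)|case: (d13 eqf)|case: (d23 eqf)
     |case: (d12 (esym eqf))|case: (d13 (esym eqf))|case: (d23 (esym eqf))].
Qed.

Hypothesis Gptol : ptolemaic G.

(** A non-neighbour z of x would be at distance 2 from x, and the quadruple
    v, x, y, z would give 2 n.+1 <= n.+1 + n. *)
Lemma ptolemaic_common_parent v x y z n :
    dist v x = 1 -> dist v y = n.+1 -> dist x y = n.+1 ->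
    dist v z = 1 -> dist z y = n ->
  dist x z = 1.
Proof.
move=> vx vy xy vz zy.
have := Gptol v x y z; rewrite vx vy xy vz (dist_sym y) zy => pt.
have xz : dist x z <> 0 by move=> /dist0_eq exz; move: xy; rewrite exz; lia.
nia.
Qed.

(** In the inequality for u, v, w, x the diagonals are uw and vx: a long vx
    would need ux to be longer than vx, but u and x are at most as far apart as
    v and x.  The vertex y then excludes v = w, which leaves d(u,w) = 2. *)
Lemma smooth_failure_diamond u v w x y :
    v \in step u w -> v \in step u y -> x \in step w y -> v \notin step u x ->
  [/\ dist u x = 1, dist v x = 1, dist v w = 1 &
      [/\ dist x y = dist v y, dist w y = (dist v y).+1 & 0 < dist v y]].
Proof.
move=> /in_step[uv uw] /in_step[_ uy] /in_step[wx wy] /negP vSux.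
have ux_le : dist u x <= dist v x.
  (* v is not a step from u to x, so the triangle inequality is strict *)
  have := dist_triangle u v x; rewrite uv leq_eqVlt => /predU1P[ux|//].
  by case: vSux; apply/in_step.
have vx_gt0 : 0 < dist v x.
  rewrite lt0n; apply/eqP => vx; move: ux_le; rewrite vx leqn0 => /eqP ux.
  by move: uv; rewrite (dist0_eq ux) -(dist0_eq vx) distxx.
have := Gptol u v w x; rewrite uv uw wx => pt.
have vx : dist v x = 1 by nia.
have wvx := dist_triangle w v x.
have uxy := dist_triangle u x y.
have uxw := dist_triangle u x w; rewrite (dist_sym x w) in uxw.
have wvy := dist_triangle w v y; rewrite (dist_sym w v) in wvy.
have vxy := dist_triangle v x y.
have vy : dist v y = 0 -> dist v x = dist x y.
  by move=> /dist0_eq <-; apply: dist_sym.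
by split; [lia|lia|lia|split; lia].
Qed.

Lemma K113_free_smooth : induced_free K113 G -> smooth G.
Proof.
move=> freeG u v w x y vSuw vSuy xSwy; apply/negPn/negP => vSux.
have [ux vx vw [xy wy vy_gt0]] := smooth_failure_diamond vSuw vSuy xSwy vSux.
move: vSuw vSuy xSwy => /in_step[uv uw] /in_step[_ uy] /in_step[wx _].
case vy: (dist v y) vy_gt0 => [//|n] _.
have [z vz zy] := dist_first_step vy.
have xz : dist x z = 1.
  by apply: (ptolemaic_common_parent vx vy) vz zy; rewrite xy.
have uzy := dist_triangle u z y; have wzy := dist_triangle w z y.
apply: freeG; apply: (@induced_K113 v x u w z);
  rewrite /= ?adj_dist ?(dist_sym v u) ?(dist_sym x u) ?(dist_sym x w);
  rewrite ?uv ?vw ?vz ?ux ?wx ?xz ?vx ?uw ?vw //; try lia.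
- by move=> euw; move: uw; rewrite euw distxx.
- by move=> euz; move: uy; rewrite euz; lia.
- by move=> ewz; move: wy; rewrite ewz; lia.
Qed.

End Connected.

Theorem theorem27 (G : sgraph) (Gconn : connected G) (Gptol : ptolemaic G) :
  smooth G <-> induced_free K113 G.
Proof.
by split; [apply: smooth_free_K113|apply: K113_free_smooth].
Qed.
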